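(* Let $A\in\mathcal S_n$, $C\in\mathcal S_m$, $E\in\mathcal S_p$, $B_1,B_2\in\mathbb R^{m\times n}$ with $B_1\ne B_2$, $D\in\mathbb R^{p\times m}$, $f\in\mathbb R^n$, $g\in\mathbb R^m$, $h\in\mathbb R^p$ be such that the coefficient matrix of the double saddle point problem $$\begin{bmatrix} A & B_1^T & 0 \\ B_2 & -C & D^T \\ 0 & D & E \end{bmatrix}\begin{bmatrix} x \\ y \\ z \end{bmatrix}=\begin{bmatrix} f \\ g \\ h \end{bmatrix}$$ is nonsingular. Let $[\tilde x^T,\tilde y^T,\tilde z^T]^T$ with $\tilde x\in\mathbb R^n,\tilde y\in\mathbb R^m,\tilde z\in\mathbb R^p$ be an approximate solution of this system (i.e. any given vector), and let $\theta_1,\theta_2,\theta_3,\theta_4,\theta_5,\theta_7,\theta_8,\theta_9,\theta_{10}\ge0$ with $\theta_8,\theta_9,\theta_{10}\ne0$. Then the sparsity-preserving structured backward error satisfies $$\eta^{\mathbb S_2}_{\rm sps}(\tilde x,\tilde y,\tilde z)=\left\|\mathcal J^T(\mathcal J\mathcal J^T)^{-1}R\right\|_2,$$ where $R=[R_f^T,R_g^T,R_h^T]^T$, $R_f=f-A\tilde x-B_1^T\tilde y$, $R_g=g-B_2\tilde x+C\tilde y-D^T\tilde z$, $R_h=h-D\tilde y-E\tilde z$, and $\mathcal J=[\widetilde{\mathcal J}\;\;\mathcal I]\in\mathbb R^{(n+m+p)\times l}$, $l=\mu+\sigma+\tau+2mn+mp+n+m+p$, with $$\widetilde{\mathcal J}=\begin{bmatrix}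 \frac1{\theta_1}\mathcal K_{\tilde x}\Phi_A\mathfrak D_{\mathcal S_n}^{-1} & \frac1{\theta_2}\mathcal N^n_{\tilde y}\Phi_{B_1} & 0 & 0 & 0 & 0 \\ 0 & 0 & \frac1{\theta_3}\mathcal M^m_{\tilde x}\Phi_{B_2} & -\frac1{\theta_4}\mathcal K_{\tilde y}\Phi_C\mathfrak D_{\mathcal S_m}^{-1} & \frac1{\theta_5}\mathcal N^m_{\tilde z}\Phi_D & 0 \\ 0 & 0 & 0 & 0 & \frac1{\theta_5}\mathcal M^p_{\tilde y}\Phi_D & \frac1{\theta_7}\mathcal K_{\tilde z}\Phi_E\mathfrak D_{\mathcal S_p}^{-1} \end{bmatrix},$$ $$\mathcal I=\begin{bmatrix} -\frac1{\theta_8}I_n & 0 & 0 \\ 0 & -\frac1{\theta_9}I_m & 0 \\ 0 & 0 & -\frac1{\theta_{10}}I_p \end{bmatrix}.$$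
   Context: Notation. $\mathcal S_k$ is the set of real symmetric $k\times k$ matrices; $\mu=\frac{n(n+1)}2$, $\sigma=\frac{m(m+1)}2$, $\tau=\frac{p(p+1)}2$. $\odot$ is the Hadamard (entrywise) product. For a real matrix $X=[x_{ij}]$, $\Theta_X$ is the matrix of the same size whose $(i,j)$ entry is $1$ if $x_{ij}\ne0$ and $0$ if $x_{ij}=0$. $\mathrm{vec}(X)$ stacks the columns of $X$. For $X\in\mathcal S_k$, $\mathrm{vec}_{\mathcal S}(X)\in\mathbb R^{k(k+1)/2}$ stacks the lower-triangular parts of the columns: $(x_{11},x_{21},\dots,x_{k1},x_{22},x_{32},\dots,x_{k2},\dots,x_{kk})^T$. $\Phi_X=\mathrm{diag}(\mathrm{vec}_{\mathcal S}(\Theta_X))$ for $X\in\{A,C,E\}$ and $\Phi_X=\mathrm{diag}(\mathrm{vec}(\Theta_X))$ for $X\in\{B_1,B_2,D\}$. $\mathfrak D_{\mathcal S_k}$ is the diagonal matrix of size $\frac{k(k+1)}2$ whose diagonal entry is $1$ at the positions in $\mathrm{vec}_{\mathcal S}$ of the diagonal entries $x_{ii}$ (positions $\frac{(2k-(i-2))(i-1)}2+1$, $i=1,\dots,k$) and $\sqrt2$ at all other positions. For $x\in\mathbb R^k$, $\mathcal K_x=[K_x^1\;K_x^2\;\cdots\;K_x^k]\in\mathbb R^{k\times k(k+1)/2}$, where $K_x^i\in\mathbb R^{k\times(k-i+1)}$ has first $i-1$ rows zero, $i$-th row equal to $(x_i,x_{i+1},\dots,x_k)$, and, for $r=i+1,\dots,k$,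 $r$-th row having the single nonzero entry $x_i$ in column $r-i+1$. For $x\in\mathbb R^{b}$, $\mathcal M^{a}_x=[x_1I_a\;x_2I_a\;\cdots\;x_bI_a]\in\mathbb R^{a\times ab}$. For $y\in\mathbb R^{a}$, $\mathcal N^{b}_y\in\mathbb R^{b\times ab}$ is the block diagonal matrix with $b$ diagonal blocks each equal to the row $y^T$. Conventions on weights. The $\theta_i$ are nonnegative reals, with $\frac1{\theta_i}:=0$ if $\theta_i=0$; $\theta_i=0$ means that the corresponding block is not perturbed (its perturbation is required to be zero). Structured backward error. $\mathbb S_2$ is the set of tuples $(\Delta A,\Delta B_1,\Delta B_2,\Delta C,\Delta D,\Delta E,\Delta f,\Delta g,\Delta h)$ with $\Delta A\in\mathcal S_n$, $\Delta B_1,\Delta B_2\in\mathbb R^{m\times n}$, $\Delta C\in\mathcal S_m$, $\Delta D\in\mathbb R^{p\times m}$, $\Delta E\in\mathcal S_p$, $\Delta f\in\mathbb R^n$, $\Delta g\in\mathbb R^m$, $\Delta h\in\mathbb R^p$ such that $$\begin{bmatrix} A+\Delta A & (B_1+\Delta B_1)^T & 0 \\ B_2+\Delta B_2 & -(C+\Delta C) & (D+\Delta D)^T \\ 0 & D+\Delta D & E+\Delta E \end{bmatrix}\begin{bmatrix} \tilde x \\ \tilde y \\ \tilde z \end{bmatrix}=\begin{bmatrix} f+\Delta f \\ g+\Delta g \\ h+\Delta h \end{bmatrix}.$$ $\eta^{\mathbb S_2}_{\rm sps}(\tilde x,\tilde y,\tilde z)$ is the minimum of $$\left(\theta_1^2\|\Delta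 A\|_F^2+\theta_2^2\|\Delta B_1\|_F^2+\theta_3^2\|\Delta B_2\|_F^2+\theta_4^2\|\Delta C\|_F^2+\theta_5^2\|\Delta D\|_F^2+\theta_7^2\|\Delta E\|_F^2+\theta_8^2\|\Delta f\|_2^2+\theta_9^2\|\Delta g\|_2^2+\theta_{10}^2\|\Delta h\|_2^2\right)^{1/2}$$ over all tuples in $\mathbb S_2$ whose matrix perturbations preserve the sparsity pattern, i.e. $\Delta X=\Delta X\odot\Theta_X$ for $X\in\{A,B_1,B_2,C,D,E\}$. *)

(* Defs.v *)
From mathcomp Require Import all_boot all_order all_algebra.
From mathcomp Require Import sesquilinear.
From mathcomp Require Import classical_sets reals.

Set Implicit Arguments.
Unset Strict Implicit.
Unset Printing Implicit Defensive.

Import Order.TTheory GRing.Theory Num.Theory.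

Local Open Scope classical_set_scope.
Local Open Scope ring_scope.

(* Lengths of vecS and vec: the sums are the block sizes of the \mxcol and
   \mxrow constructions below, dimSE and dimME give the closed forms. *)
Definition dimS (k : nat) : nat := (\sum_(i < k) (k - i))%N.
Definition dimM (a b : nat) : nat := (\sum_(j < b) a)%N.

Lemma dimSE (k : nat) : dimS k = (k * k.+1)./2.
Proof.
rewrite /dimS (reindex_inj rev_ord_inj) /=.
rewrite (eq_bigr (fun i : 'I_k => i.+1)); last first.
  by move=> i _; rewrite subKn.
elim: k => [|k IHk]; first by rewrite big_ord0.
rewrite big_ord_recr IHk.
have -> : (k.+1 * k.+2 = k * k.+1 + k.+1.*2)%N.
  by rewrite -muln2 [(k * _)%N]mulnC -mulnDr addn2.
by rewrite halfD odd_double andbF doubleK.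
Qed.

Lemma dimME (a b : nat) : dimM a b = (a * b)%N.
Proof. by rewrite /dimM sum_nat_const card_ord mulnC. Qed.

Lemma offset_proof (k : nat) (i : 'I_k) (c : 'I_(k - i)) : (i + c < k)%N.
Proof. by rewrite -ltn_subRL. Qed.

Definition offset (k : nat) (i : 'I_k) (c : 'I_(k - i)) : 'I_k :=
  Ordinal (offset_proof c).

Section Vectorization.
Variable R : realType.

Definition hadamard (a b : nat) (X Y : 'M[R]_(a, b)) : 'M[R]_(a, b) :=
  map2_mx *%R X Y.

Definition Theta (a b : nat) (X : 'M[R]_(a, b)) : 'M[R]_(a, b) :=
  map_mx (fun t : R => (t != 0)%:R) X.

Definition vec (a b : nat) (X : 'M[R]_(a, b)) : 'cV[R]_(dimM a b) :=
  \mxcol_(j < b) col j X.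

Definition vecS (k : nat) (X : 'M[R]_k) : 'cV[R]_(dimS k) :=
  \mxcol_(i < k) (\col_(c < k - i) X (offset c) i).

Definition PhiS (k : nat) (X : 'M[R]_k) : 'M[R]_(dimS k) :=
  diag_mx (vecS (Theta X))^T.

Definition Phi (a b : nat) (X : 'M[R]_(a, b)) : 'M[R]_(dimM a b) :=
  diag_mx (vec (Theta X))^T.

(* In the i-th block of vecS X, the index c = 0 holds the diagonal entry. *)
Definition DS (k : nat) : 'M[R]_(dimS k) :=
  diag_mx (\mxrow_(i < k)
             (\row_(c < k - i) if c == 0 :> nat then 1 else Num.sqrt 2)).

(* Indices start from 0: the column r - i + 1 of the usual numbering is the
   column r - i here. *)
Definition Kblock (k : nat) (x : 'cV[R]_k) (i : 'I_k) : 'M[R]_(k, k - i) :=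
  \matrix_(r < k, c < k - i)
    if (r < i)%N then 0
    else if r == i then x (offset c) 0
    else if c == (r - i)%N :> nat then x i 0 else 0.

Definition Kmx (k : nat) (x : 'cV[R]_k) : 'M[R]_(k, dimS k) :=
  \mxrow_(i < k) Kblock x i.

Definition Mmx (a b : nat) (x : 'cV[R]_b) : 'M[R]_(a, dimM a b) :=
  \mxrow_(j < b) (x j 0)%:M.

(* The j-th block of columns has y^T in row j and zeros elsewhere. *)
Definition Nmx (a b : nat) (y : 'cV[R]_a) : 'M[R]_(b, dimM a b) :=
  \mxrow_(j < b) (delta_mx j 0 *m y^T).

Definition normF (a b : nat) (X : 'M[R]_(a, b)) : R :=
  Num.sqrt (\sum_i \sum_j X i j ^+ 2).

Definition norm2 (a : nat) (v : 'cV[R]_a) : R :=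
  Num.sqrt (\sum_i v i 0 ^+ 2).

End Vectorization.

Arguments DS : clear implicits.
Arguments Mmx {R} a {b} x.
Arguments Nmx {R a} b y.

(* Used both for the data of a double saddle point system and for a
   perturbation of it. *)
Record blocks (R : realType) (n m p : nat) := Blocks {
  blkA : 'M[R]_n;
  blkB1 : 'M[R]_(m, n);
  blkB2 : 'M[R]_(m, n);
  blkC : 'M[R]_m;
  blkD : 'M[R]_(p, m);
  blkE : 'M[R]_p;
  blkf : 'cV[R]_n;
  blkg : 'cV[R]_m;
  blkh : 'cV[R]_p
}.

Record weights (R : realType) := Weights {
  theta1 : R; theta2 : R; theta3 : R; theta4 : R; theta5 : R;
  theta7 : R; theta8 : R; theta9 : R; theta10 : R
}.

Section DoubleSaddlePoint.
Variables (R : realType) (n m p : nat).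
Implicit Types (S d : blocks R n m p) (w : weights R).
Implicit Types (xt : 'cV[R]_n) (yt : 'cV[R]_m) (zt : 'cV[R]_p).

Definition coefmx S : 'M[R]_(n + (m + p)) :=
  col_mx (row_mx (blkA S) (row_mx (blkB1 S)^T 0))
 (col_mx (row_mx (blkB2 S) (row_mx (- blkC S) (blkD S)^T))
         (row_mx 0 (row_mx (blkD S) (blkE S)))).

Definition rhs S : 'cV[R]_(n + (m + p)) :=
  col_mx (blkf S) (col_mx (blkg S) (blkh S)).

Definition perturb S d : blocks R n m p :=
  Blocks (blkA S + blkA d) (blkB1 S + blkB1 d) (blkB2 S + blkB2 d)
         (blkC S + blkC d) (blkD S + blkD d) (blkE S + blkE d)
         (blkf S + blkf d) (blkg S + blkg d) (blkh S + blkh d).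

Definition S2 S xt yt zt : set (blocks R n m p) :=
  [set d | [/\ blkA d \is symmetricmx, blkC d \is symmetricmx,
               blkE d \is symmetricmx &
               coefmx (perturb S d) *m col_mx xt (col_mx yt zt)
               = rhs (perturb S d)]].

Definition sparsity_preserving S : set (blocks R n m p) :=
  [set d | [/\ blkA d = hadamard (blkA d) (Theta (blkA S)),
               blkB1 d = hadamard (blkB1 d) (Theta (blkB1 S)) &
               blkB2 d = hadamard (blkB2 d) (Theta (blkB2 S))]
        /\ [/\ blkC d = hadamard (blkC d) (Theta (blkC S)),
               blkD d = hadamard (blkD d) (Theta (blkD S)) &
               blkE d = hadamard (blkE d) (Theta (blkE S))]].

(* A zero weight means that the corresponding block is not perturbed. *)
Definition weight_admissible w : set (blocks R n m p) :=
  [set d | [/\ theta1 w = 0 -> blkA d = 0,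
               theta2 w = 0 -> blkB1 d = 0 &
               theta3 w = 0 -> blkB2 d = 0]
        /\ [/\ theta4 w = 0 -> blkC d = 0,
               theta5 w = 0 -> blkD d = 0 &
               theta7 w = 0 -> blkE d = 0]
        /\ [/\ theta8 w = 0 -> blkf d = 0,
               theta9 w = 0 -> blkg d = 0 &
               theta10 w = 0 -> blkh d = 0]].

Definition weighted_norm w d : R :=
  Num.sqrt (theta1 w ^+ 2 * normF (blkA d) ^+ 2
          + theta2 w ^+ 2 * normF (blkB1 d) ^+ 2
          + theta3 w ^+ 2 * normF (blkB2 d) ^+ 2
          + theta4 w ^+ 2 * normF (blkC d) ^+ 2
          + theta5 w ^+ 2 * normF (blkD d) ^+ 2
          + theta7 w ^+ 2 * normF (blkE d) ^+ 2
          + theta8 w ^+ 2 * norm2 (blkf d) ^+ 2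
          + theta9 w ^+ 2 * norm2 (blkg d) ^+ 2
          + theta10 w ^+ 2 * norm2 (blkh d) ^+ 2).

Definition is_minimum (V : set R) (v : R) : Prop := V v /\ lbound V v.

(* eta is the sparsity-preserving structured backward error: a minimum that
   is attained, not merely an infimum. *)
Definition is_eta_S2_sps S w xt yt zt (eta : R) : Prop :=
  is_minimum [set weighted_norm w d | d in
                S2 S xt yt zt `&` sparsity_preserving S `&`
                weight_admissible w] eta.

Definition residual S xt yt zt : 'cV[R]_(n + (m + p)) :=
  col_mx (blkf S - blkA S *m xt - (blkB1 S)^T *m yt)
 (col_mx (blkg S - blkB2 S *m xt + blkC S *m yt - (blkD S)^T *m zt)
         (blkh S - blkD S *m yt - blkE S *m zt)).

(* In a field type 0^-1 = 0, which is the convention 1/theta := 0 for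
   theta = 0. *)
Definition Jtilde S w xt yt zt :
  'M[R]_(n + (m + p),
    dimS n + (dimM m n + (dimM m n + (dimS m + (dimM p m + dimS p))))) :=
  col_mx
    (row_mx ((theta1 w)^-1 *: (Kmx xt *m PhiS (blkA S) *m invmx (DS R n)))
    (row_mx ((theta2 w)^-1 *: (Nmx n yt *m Phi (blkB1 S)))
    (row_mx 0 (row_mx 0 (row_mx 0 0)))))
 (col_mx
    (row_mx 0
    (row_mx 0
    (row_mx ((theta3 w)^-1 *: (Mmx m xt *m Phi (blkB2 S)))
    (row_mx (- (theta4 w)^-1 *: (Kmx yt *m PhiS (blkC S) *m invmx (DS R m)))
    (row_mx ((theta5 w)^-1 *: (Nmx m zt *m Phi (blkD S))) 0)))))
    (row_mx 0 (row_mx 0 (row_mx 0 (row_mx 0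
    (row_mx ((theta5 w)^-1 *: (Mmx p yt *m Phi (blkD S)))
            ((theta7 w)^-1 *: (Kmx zt *m PhiS (blkE S) *m invmx (DS R p)))
    )))))).

Definition Imx w : 'M[R]_(n + (m + p)) :=
  col_mx (row_mx (- (theta8 w)^-1)%:M (row_mx 0 0))
 (col_mx (row_mx 0 (row_mx (- (theta9 w)^-1)%:M 0))
         (row_mx 0 (row_mx 0 (- (theta10 w)^-1)%:M))).

Definition Jmx S w xt yt zt := row_mx (Jtilde S w xt yt zt) (Imx w).

End DoubleSaddlePoint.

(* Main.v *)
Require Import Defs.
From mathcomp Require Import all_boot all_order all_algebra.
From mathcomp Require Import sesquilinear ring.
From mathcomp Require Import classical_sets reals.

Set Implicit Arguments.
Unset Strict Implicit.
Unset Printing Implicit Defensive.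

Import Order.TTheory GRing.Theory Num.Theory.

Local Open Scope ring_scope.

(* Rescaling the independent entries of a perturbation by the weights, and the
   off-diagonal entries of its symmetric blocks by [sqrt 2], turns the weighted
   norm into the Euclidean norm of a vector [v] and the perturbed system into
   [J v = R].  The block [I] makes [J] surjective, so [J^T (J J^T)^-1 R] is the
   solution of least norm.  It is attained because every vector [J^T l] is the
   coordinate vector of an explicit admissible perturbation. *)

(** [symmetricmx] is stated through a sign and a field morphism; with trivial sign and identity
    morphism only [X^T = X] remains. *)
Lemma symmetricmxP (R : fieldType) (k : nat) (X : 'M[R]_k) :
  reflect (X^T = X) (X \is symmetricmx).
Proof.
apply: (iffP (is_hermitianmxP _ _ _)); rewrite expr0 scale1r => XE.
  by rewrite [RHS]XE; apply/matrixP => i j; rewrite !mxE.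
by rewrite -[LHS]XE; apply/matrixP => i j; rewrite !mxE.
Qed.

Lemma trmx_eq_entry (T : Type) (k : nat) (X : 'M[T]_k) (i j : 'I_k) :
  X^T = X -> X i j = X j i.
Proof. by move=> Xsym; rewrite -[in LHS]Xsym mxE. Qed.

(** * Euclidean norms, Gram matrices and least-norm solutions *)

Section Norm.
Variable R : realType.

Definition sqnorm (a : nat) (v : 'cV[R]_a) : R := \sum_i v i 0 ^+ 2.

Lemma sqnorm_ge0 (a : nat) (v : 'cV[R]_a) : 0 <= sqnorm v.
Proof. by apply: sumr_ge0 => i _; exact: sqr_ge0. Qed.

Lemma sqnorm_dot (a : nat) (v : 'cV[R]_a) : sqnorm v = (v^T *m v) 0 0.
Proof. by rewrite mxE; apply: eq_bigr => i _; rewrite mxE expr2. Qed.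

Lemma sqnorm_eq0 (a : nat) (v : 'cV[R]_a) : sqnorm v = 0 -> v = 0.
Proof.
move=> /eqP; rewrite psumr_eq0 => [/allP v0|i _]; last exact: sqr_ge0.
apply/colP => i; rewrite mxE; apply/eqP.
by rewrite -sqrf_eq0; apply: (implyP (v0 i _)); rewrite ?mem_index_enum.
Qed.

Lemma sqnormZ (a : nat) (t : R) (v : 'cV[R]_a) :
  sqnorm (t *: v) = t ^+ 2 * sqnorm v.
Proof. by rewrite mulr_sumr; apply: eq_bigr => i _; rewrite mxE exprMn. Qed.

Lemma sqnorm_col_mx (a b : nat) (u : 'cV[R]_a) (v : 'cV[R]_b) :
  sqnorm (col_mx u v) = sqnorm u + sqnorm v.
Proof.
rewrite /sqnorm big_split_ord /=.
by congr (_ + _); apply: eq_bigr => i _; rewrite (col_mxEu, col_mxEd).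
Qed.

Lemma norm2E (a : nat) (v : 'cV[R]_a) : norm2 v ^+ 2 = sqnorm v.
Proof. by rewrite sqr_sqrtr ?sqnorm_ge0. Qed.

Lemma normFE (a b : nat) (X : 'M[R]_(a, b)) :
  normF X ^+ 2 = \sum_i \sum_j X i j ^+ 2.
Proof.
by rewrite sqr_sqrtr //; do 2!apply: sumr_ge0 => ? _; exact: sqr_ge0.
Qed.

(** If [u J J^T = 0] for a row [u], then [|J^T u^T|^2 = u J J^T u^T = 0], hence [u = 0]. *)
Lemma gram_unitmx (a b : nat) (J : 'M[R]_(a, b)) :
  (forall u : 'cV[R]_a, J^T *m u = 0 -> u = 0) -> J *m J^T \in unitmx.
Proof.
move=> Jinj; rewrite -row_free_unit -kermx_eq0; apply/eqP/row_matrixP => i.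
rewrite row0; set u := row i _.
have uJJ : u *m (J *m J^T) = 0 by apply/sub_kermxP/row_sub.
apply: trmx_inj; rewrite trmx0; apply/Jinj/sqnorm_eq0.
by rewrite sqnorm_dot trmx_mul !trmxK mulmxA -(mulmxA u) uJJ mul0mx mxE.
Qed.

(* [J^T (J J^T)^-1 r] is orthogonal to [ker J], which contains its difference
   with any other solution. *)
Lemma norm2_least (a b : nat) (J : 'M[R]_(a, b)) (r : 'cV[R]_a)
    (v : 'cV[R]_b) :
  J *m J^T \in unitmx -> J *m v = r ->
  norm2 (J^T *m invmx (J *m J^T) *m r) <= norm2 v.
Proof.
move=> JJu Jv; set u := _ *m r.
rewrite ler_wsqrtr // -/(sqnorm u) -/(sqnorm v).
have Ju : J *m u = r by rewrite /u !mulmxA mulmxV // mul1mx.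
have Jd : J *m (v - u) = 0 by rewrite mulmxBr Jv Ju subrr.
have ud : u^T *m (v - u) = 0.
  by rewrite {1}/u -(mulmxA J^T) trmx_mul trmxK -mulmxA Jd mulmx0.
have du : (v - u)^T *m u = 0.
  by apply: trmx_inj; rewrite trmx_mul trmxK ud trmx0.
have -> : sqnorm v = sqnorm u + sqnorm (v - u).
  rewrite -[v in LHS](subrK u) addrC !sqnorm_dot mulmxDr.
  rewrite [(u + _)^T]linearD /= !mulmxDl.
  by rewrite ud du addr0 add0r mxE.
by rewrite lerDl sqnorm_ge0.
Qed.

End Norm.

(** * Symmetric blocks: [vecS], [Kmx] and the scaling [DS] *)

Section SymmetricVectorization.
Variables (R : realType) (k : nat).
Implicit Types (x l : 'cV[R]_k) (X Y : 'M[R]_k) (s : 'I_(dimS k)) (t : R).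

(** A flat position of [vecS] decodes into a block, which is the column, and an offset counted down
    from the diagonal; hence [colS s <= rowS s]. *)
Definition colS s : 'I_k := tagnat.sig1 s.
Definition rowS s : 'I_k := offset (tagnat.sig2 s).

(** In column [i], adding [i] to the offset maps ['I_(k - i)] bijectively onto the rows [a >= i]. *)
Lemma big_dimS (F : 'I_k -> 'I_k -> R) :
  \sum_s F (rowS s) (colS s) = \sum_(i < k) \sum_(a < k | (i <= a)%N) F a i.
Proof.
transitivity (\sum_(i < k) \sum_(c < k - i) F (offset c) i).
  by rewrite sig_big_dep (reindex _ tagnat.sig_bij_on).
apply: eq_bigr => i _.
have lt_sub (a : 'I_k) : (a - i < k - i)%N by rewrite ltn_sub2r ?ltn_ord.
rewrite [RHS](reindex (@offset k i)) /=.
  by apply: eq_bigl => c; rewrite leq_addr.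
exists (fun a => Ordinal (lt_sub a)) => [c _|a le_ia]; apply: val_inj => /=.
  by rewrite addKn.
exact: subnKC.
Qed.

(* Each off-diagonal position of the lower triangle also accounts for its
   transpose. *)
Lemma big_dimS_sym (F : 'I_k -> 'I_k -> R) :
  \sum_s (F (rowS s) (colS s) +
          (rowS s != colS s)%:R * F (colS s) (rowS s))
  = \sum_i \sum_a F a i.
Proof.
rewrite (big_dimS (fun a i => F a i + (a != i)%:R * F i a)).
under eq_bigr do rewrite big_split /=.
rewrite big_split /=.
under [RHS]eq_bigr => i _ do rewrite (bigID (fun a : 'I_k => (i <= a)%N)) /=.
rewrite big_split /=; congr (_ + _).
(* After the exchange both sides run over the entries strictly above the diagonal; the indicator
   removes the diagonal itself. *)
rewrite (exchange_big_dep xpredT) //=; apply: eq_bigr => i _.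
rewrite [LHS]big_mkcond [RHS]big_mkcond /=; apply: eq_bigr => a _.
rewrite -ltnNge ltn_neqAle -val_eqE eq_sym /=.
by case: (_ == _) => /=; case: leqP; rewrite ?mul0r ?mul1r.
Qed.

Lemma vecSE X s : vecS X s 0 = X (rowS s) (colS s).
Proof. by rewrite !mxE. Qed.

(** Position [(a, i)] stands for both [X a i] and [X i a], so its column is [x_a e_i + x_i e_a],
    with the second term dropped when [a = i]. *)
Lemma KmxE x r s :
  Kmx x r s = (r == colS s)%:R * x (rowS s) 0
            + (rowS s != colS s)%:R * ((r == rowS s)%:R * x (colS s) 0).
Proof.
rewrite !mxE -/(colS s); set i := colS s.
have -> : (tagnat.sig2 s == r - i :> nat)%N = (r - i == rowS s - i)%N.
  by rewrite /rowS /= addKn eq_sym.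
have le_ia : (i <= rowS s)%N by exact: leq_addr.
rewrite -/(rowS s); move: le_ia; move: (rowS s) => a le_ia.
case: ltnP => [lt_ri|le_ir].
  have /negPf -> : r != i by rewrite -val_eqE ltn_eqF.
  have /negPf -> : r != a by rewrite -val_eqE ltn_eqF // (leq_trans lt_ri).
  by rewrite !mul0r mulr0 addr0.
have [->|ne_ri] := eqVneq r i.
  rewrite mul1r [i == a]eq_sym; have [_|_] := eqVneq a i.
    by rewrite mul0r addr0.
  by rewrite mul0r mulr0 addr0.
(* Truncated subtraction of [i] can be cancelled because [i <= r] and [i <= a]. *)
rewrite mul0r add0r eqn_sub2rE // val_eqE.
have [<-|_] := eqVneq r a; first by rewrite ne_ri !mul1r.
by rewrite mul0r mulr0.
Qed.

Lemma Kmx_vecS x X : X^T = X -> Kmx x *m vecS X = X *m x.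
Proof.
move=> Xsym; apply/colP => r; rewrite !mxE.
(* The indicator selects row [r] from a sum over all entries, the shape that [big_dimS_sym]
   needs. *)
transitivity (\sum_i \sum_a (r == i)%:R * (X a i * x a 0)).
  rewrite -big_dimS_sym; apply: eq_bigr => s _.
  rewrite vecSE KmxE (trmx_eq_entry (colS s) _ Xsym); ring.
rewrite (bigD1 r) //= [X in _ + X]big1 ?addr0 => [|i].
  apply: eq_bigr => a _; rewrite eqxx mul1r.
  by rewrite (trmx_eq_entry _ _ Xsym).
by rewrite eq_sym => /negPf ->; apply: big1 => a _; rewrite mul0r.
Qed.

(** Off the diagonal this is the entry of [l x^T + x l^T], on the diagonal only half of it. The
    squares of the entries of [DS] compensate for this. *)
Lemma trKmx_mul x l s :
  ((Kmx x)^T *m l) s 0 = x (rowS s) 0 * l (colS s) 0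
     + (rowS s != colS s)%:R * (x (colS s) 0 * l (rowS s) 0).
Proof.
have sum_pick (c : R) (i : 'I_k) :
    \sum_r (r == i)%:R * c * l r 0 = c * l i 0.
  rewrite (bigD1 i) //= eqxx mul1r big1 ?addr0 // => r /negPf ->.
  by rewrite !mul0r.
rewrite mxE -sum_pick -(sum_pick (x (colS s) 0)) mulr_sumr -big_split /=.
by apply: eq_bigr => r _; rewrite mxE KmxE mulrDl !mulrA.
Qed.

Definition dS s : R := if rowS s == colS s then 1 else Num.sqrt 2.

Lemma DS_diag : DS R k = diag_mx (\row_s dS s).
Proof.
congr diag_mx; apply/rowP => s; rewrite !mxE /dS -val_eqE /=.
by have := eqn_add2l (colS s) (tagnat.sig2 s) 0; rewrite addn0 => ->.
Qed.

(** Written as a multiplicity, one on the diagonal and two off it, to match [big_dimS_sym]. *)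
Lemma sqr_dS s : dS s ^+ 2 = 1 + (rowS s != colS s)%:R.
Proof.
rewrite /dS; case: eqP => _; first by rewrite expr1n addr0.
by rewrite sqr_sqrtr ?ler0n.
Qed.

Lemma DS_unitmx : DS R k \in unitmx.
Proof.
rewrite DS_diag unitmxE det_diag unitfE; apply/prodf_neq0 => s _.
rewrite mxE -sqrf_eq0 sqr_dS; apply: lt0r_neq0.
by rewrite ltr_pwDl ?ltr01 ?ler0n.
Qed.

Definition coordS t X : 'cV[R]_(dimS k) := t *: (DS R k *m vecS X).

Definition jacS t Y x : 'M[R]_(k, dimS k) :=
  t^-1 *: (Kmx x *m PhiS Y *m invmx (DS R k)).

(* The preimage of [(jacS t Y x)^T *m l] under [coordS t]. *)
Definition pertS t Y x l : 'M[R]_k :=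
  (t^-1 ^+ 2 / 2) *: hadamard (l *m x^T + x *m l^T) (Theta Y).

Lemma sqnorm_coordS t X : X^T = X ->
  sqnorm (coordS t X) = t ^+ 2 * normF X ^+ 2.
Proof.
move=> Xsym; rewrite sqnormZ normFE exchange_big /=; congr (_ * _).
rewrite -(big_dimS_sym (fun a i => X a i ^+ 2)).
apply: eq_bigr => s _; rewrite DS_diag mul_diag_mx !mxE -/(rowS s) -/(colS s).
by rewrite (trmx_eq_entry (colS s) _ Xsym) exprMn sqr_dS mulrDl mul1r.
Qed.

Lemma PhiS_vecS X Y : PhiS Y *m vecS X = vecS (hadamard X (Theta Y)).
Proof.
by apply/colP => s; rewrite mul_diag_mx !mxE mulrC.
Qed.

Lemma jacS_coordS t X Y x :
  X^T = X -> X = hadamard X (Theta Y) -> (t = 0 -> X = 0) ->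
  jacS t Y x *m coordS t X = X *m x.
Proof.
move=> Xsym Xsp Xt; rewrite /jacS /coordS -scalemxAl -scalemxAr scalerA.
(* For zero weight the left side vanishes, and so does [X x] since the block is unperturbed. *)
have [t0|t0] := eqVneq t 0; first by rewrite t0 mulr0 scale0r Xt // mul0mx.
rewrite mulVf // scale1r mulmxA mulmxKV ?DS_unitmx //.
by rewrite -mulmxA PhiS_vecS -Xsp Kmx_vecS.
Qed.

(** The ratio of the adjoint entry of [Kmx] to the entry of [l x^T + x l^T] is 1/2 on the diagonal
    and 1 off it, which is [dS s ^+ 2 / 2] in both cases. This explains the 2 in [pertS]. *)
Lemma trjacS_mul t Y x l :
  (jacS t Y x)^T *m l = coordS t (pertS t Y x l).
Proof.
have DSt : (DS R k)^T = DS R k by rewrite tr_diag_mx.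
(* Multiplying by [DS] cancels its inverse on the left and produces its square on the right. *)
apply: (can_inj (mulKmx DS_unitmx)).
rewrite /jacS /coordS linearZ /= !trmx_mul trmx_inv DSt tr_diag_mx.
rewrite -scalemxAl -!scalemxAr !mulmxA mulmxV ?DS_unitmx // mul1mx -mulmxA.
apply/colP => s; rewrite DS_diag mul_diag_mx -mulmxA !mul_diag_mx.
rewrite 2!mxE trKmx_mul; rewrite !mxE !big_ord1 !mxE -/(rowS s) -/(colS s).
rewrite [RHS](_ : _ = t * dS s ^+ 2 * (t^-1 ^+ 2 / 2 *
  ((l (rowS s) 0 * x (colS s) 0 + x (rowS s) 0 * l (colS s) 0) *
   (Y (rowS s) (colS s) != 0)%:R))); last by ring.
rewrite sqr_dS.
(* True also at [t = 0], where both sides are 0. *)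
have : t^-1 = t * t^-1 ^+ 2.
  have [->|t0] := eqVneq t 0; first by rewrite invr0 mul0r.
  by field.
move: t^-1 => q {1}->.
by case: (rowS s =P colS s) => [->|_] /=; field.
Qed.

Lemma pertS_sparse t Y x l :
  pertS t Y x l = hadamard (pertS t Y x l) (Theta Y).
Proof.
apply/matrixP => i j; rewrite !mxE.
by case: (_ != 0); rewrite ?mulr1 // !mulr0.
Qed.

Lemma pertS_sym t Y x l : Y^T = Y -> (pertS t Y x l)^T = pertS t Y x l.
Proof.
move=> Ysym; apply/matrixP => i j; rewrite !mxE !big_ord1 !mxE.
rewrite (trmx_eq_entry j _ Ysym); ring.
Qed.

End SymmetricVectorization.

(** * Unstructured blocks: [vec], [Mmx] and [Nmx] *)

Section Vectorization.
Variables (R : realType) (a b : nat).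
Implicit Types (X Y : 'M[R]_(a, b)) (t : R).
Implicit Types (x : 'cV[R]_b) (y : 'cV[R]_a).

Lemma sqnorm_vec X : sqnorm (vec X) = normF X ^+ 2.
Proof.
rewrite sqnorm_dot /vec tr_mxcol mul_mxrow_mxcol normFE exchange_big summxE.
apply: eq_bigr => j _; rewrite -sqnorm_dot.
by apply: eq_bigr => i _; rewrite mxE.
Qed.

Lemma Phi_vec X Y : Phi Y *m vec X = vec (hadamard X (Theta Y)).
Proof. by apply/colP => s; rewrite mul_diag_mx !mxE mulrC. Qed.

Lemma Mmx_vec x X : Mmx a x *m vec X = X *m x.
Proof.
rewrite /Mmx /vec mul_mxrow_mxcol; apply/colP => i.
rewrite summxE mxE; apply: eq_bigr => j _.
by rewrite mul_scalar_mx !mxE mulrC.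
Qed.

Lemma Nmx_vec y X : Nmx b y *m vec X = X^T *m y.
Proof.
rewrite /Nmx /vec mul_mxrow_mxcol; apply/colP => i.
rewrite summxE (bigD1 i) //= big1 ?addr0 => [|j ji].
  rewrite -mulmxA mxE big_ord1 !mxE !eqxx mul1r.
  by apply: eq_bigr => r _; rewrite !mxE mulrC.
by rewrite -mulmxA mxE big_ord1 mxE eq_sym (negPf ji) mul0r.
Qed.

(** Since [y^T X x] is the Frobenius product of [y x^T] and [X], the maps sending [X] to [X x] and
    to [X^T y] have adjoints with the same value [y x^T]. *)
Lemma trMmx_mul x y : (Mmx a x)^T *m y = vec (y *m x^T).
Proof.
rewrite /Mmx /vec tr_mxrow mxcol_mul; apply: eq_mxcol => j.
apply/colP => i; rewrite tr_scalar_mx mul_scalar_mx !mxE big_ord1 mxE; ring.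
Qed.

Lemma trNmx_mul y x : (Nmx b y)^T *m x = vec (y *m x^T).
Proof.
rewrite /Nmx /vec tr_mxrow mxcol_mul; apply: eq_mxcol => j.
apply/colP => i; rewrite trmx_mul trmxK trmx_delta -mulmxA.
by rewrite -rowE !mxE !big_ord1 !mxE.
Qed.

Definition jacM t Y x : 'M[R]_(a, dimM a b) := t^-1 *: (Mmx a x *m Phi Y).
Definition jacN t Y y : 'M[R]_(b, dimM a b) := t^-1 *: (Nmx b y *m Phi Y).
Definition coord t X : 'cV[R]_(dimM a b) := t *: vec X.
(** The inverse weight is squared so that one factor [t^-1] survives the multiplication by [t] in
    [coord]. *)
Definition pert t Y (Z : 'M[R]_(a, b)) : 'M[R]_(a, b) :=
  t^-1 ^+ 2 *: hadamard Z (Theta Y).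

Lemma sqnorm_coord t X : sqnorm (coord t X) = t ^+ 2 * normF X ^+ 2.
Proof. by rewrite sqnormZ sqnorm_vec. Qed.

Lemma jacM_coord t X Y x :
  X = hadamard X (Theta Y) -> (t = 0 -> X = 0) ->
  jacM t Y x *m coord t X = X *m x.
Proof.
move=> Xsp Xt; rewrite /jacM /coord -scalemxAl -scalemxAr scalerA.
have [t0|t0] := eqVneq t 0; first by rewrite t0 mulr0 scale0r Xt // mul0mx.
by rewrite mulVf // scale1r -mulmxA Phi_vec -Xsp Mmx_vec.
Qed.

Lemma jacN_coord t X Y y :
  X = hadamard X (Theta Y) -> (t = 0 -> X = 0) ->
  jacN t Y y *m coord t X = X^T *m y.
Proof.
move=> Xsp Xt; rewrite /jacN /coord -scalemxAl -scalemxAr scalerA.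
have [t0|t0] := eqVneq t 0.
  by rewrite t0 mulr0 scale0r Xt // trmx0 mul0mx.
by rewrite mulVf // scale1r -mulmxA Phi_vec -Xsp Nmx_vec.
Qed.

Lemma coord_pert t Y Z : coord t (pert t Y Z) = t^-1 *: (Phi Y *m vec Z).
Proof.
rewrite Phi_vec; apply/colP => s; rewrite !mxE mulrA; congr (_ * _).
have [->|t0] := eqVneq t 0; first by rewrite invr0 mul0r.
by field.
Qed.

Lemma pert_sparse t Y Z : pert t Y Z = hadamard (pert t Y Z) (Theta Y).
Proof.
apply/matrixP => i j; rewrite !mxE.
by case: (_ != 0); rewrite ?mulr1 // !mulr0.
Qed.

Lemma trjacM_mul t Y x y :
  (jacM t Y x)^T *m y = coord t (pert t Y (y *m x^T)).
Proof.
rewrite coord_pert linearZ /= trmx_mul tr_diag_mx -scalemxAl -mulmxA.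
by rewrite trMmx_mul.
Qed.

Lemma trjacN_mul t Y x y :
  (jacN t Y y)^T *m x = coord t (pert t Y (y *m x^T)).
Proof.
rewrite coord_pert linearZ /= trmx_mul tr_diag_mx -scalemxAl -mulmxA.
by rewrite trNmx_mul.
Qed.

End Vectorization.

(** * Assembling the blocks into [Jmx] *)

Section BackwardError.
Variables (R : realType) (n m p : nat).
Implicit Types (S d : blocks R n m p) (w : weights R).
Implicit Types (xt lf : 'cV[R]_n) (yt lg : 'cV[R]_m) (zt lh : 'cV[R]_p).

Definition coords w d :=
  col_mx
    (col_mx (coordS (theta1 w) (blkA d))
    (col_mx (coord (theta2 w) (blkB1 d))
    (col_mx (coord (theta3 w) (blkB2 d))
    (col_mx (coordS (theta4 w) (blkC d))
    (col_mx (coord (theta5 w) (blkD d))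
            (coordS (theta7 w) (blkE d)))))))
    (col_mx (theta8 w *: blkf d)
    (col_mx (theta9 w *: blkg d) (theta10 w *: blkh d))).

(** The minus signs come from [- C] and from the right-hand side. The [D] block has two terms
    because [D] acts in the third block row and [D^T] in the second. *)
Definition adjoint_pert S w xt yt zt lf lg lh : blocks R n m p :=
  Blocks (pertS (theta1 w) (blkA S) xt lf)
         (pert (theta2 w) (blkB1 S) (yt *m lf^T))
         (pert (theta3 w) (blkB2 S) (lg *m xt^T))
         (- pertS (theta4 w) (blkC S) yt lg)
         (pert (theta5 w) (blkD S) (zt *m lg^T + lh *m yt^T))
         (pertS (theta7 w) (blkE S) zt lh)
         (- ((theta8 w)^-1 ^+ 2 *: lf)) (- ((theta9 w)^-1 ^+ 2 *: lg))
         (- ((theta10 w)^-1 ^+ 2 *: lh)).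

Lemma residualE S xt yt zt :
  residual S xt yt zt = rhs S - coefmx S *m col_mx xt (col_mx yt zt).
Proof.
rewrite /residual /rhs /coefmx !mul_col_mx !mul_row_col !mul0mx addr0 add0r.
by rewrite !opp_col_mx !add_col_mx mulNmx !opprD opprK !addrA.
Qed.

(** By linearity the unperturbed part moves to the right, where it forms the residual. *)
Lemma perturbed_system S d (u : 'cV[R]_(n + (m + p))) :
  coefmx (perturb S d) *m u = rhs (perturb S d) <->
  coefmx d *m u - rhs d = rhs S - coefmx S *m u.
Proof.
have -> : coefmx (perturb S d) = coefmx S + coefmx d.
  by rewrite /coefmx !add_col_mx !add_row_mx !linearD /= !addr0.
have -> : rhs (perturb S d) = rhs S + rhs d by rewrite /rhs !add_col_mx.
rewrite mulmxDl; split => [sysE|/eqP].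
  by apply/eqP; rewrite subr_eq addrAC -sysE addrAC subrr add0r.
by rewrite subr_eq addrAC eq_sym subr_eq [dK in _ == dK]addrC => /eqP.
Qed.

Lemma norm2_coords w d :
  (blkA d)^T = blkA d -> (blkC d)^T = blkC d -> (blkE d)^T = blkE d ->
  norm2 (coords w d) = weighted_norm w d.
Proof.
move=> Asym Csym Esym; rewrite /norm2 -/(sqnorm _) /weighted_norm.
rewrite !sqnorm_col_mx !sqnorm_coordS // !sqnorm_coord !sqnormZ -!norm2E.
by rewrite !addrA.
Qed.

(** Each block of [Jmx] undoes the scaling of its coordinates, so the constraint on [d] becomes a
    linear system for [coords w d]. *)
Lemma Jmx_coords S w xt yt zt d :
  theta8 w != 0 -> theta9 w != 0 -> theta10 w != 0 ->
  (blkA d)^T = blkA d -> (blkC d)^T = blkC d -> (blkE d)^T = blkE d ->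
  sparsity_preserving S d -> weight_admissible w d ->
  Jmx S w xt yt zt *m coords w d
  = coefmx d *m col_mx xt (col_mx yt zt) - rhs d.
Proof.
move=> t8 t9 t10 Asym Csym Esym [[spA spB1 spB2] [spC spD spE]].
move=> [[wA wB1 wB2] [[wC wD wE] _]].
rewrite /Jmx /Jtilde /Imx /coords /coefmx /rhs.
rewrite -/(jacS _ _ _) -/(jacS (theta7 w) _ _) scaleNr -/(jacS _ (blkC S) _).
rewrite -/(jacN _ _ _) -/(jacN (theta5 w) _ _).
rewrite -/(jacM _ _ _) -/(jacM (theta5 w) _ _).
rewrite !mul_row_col !mul_col_mx !mul_row_col !mul0mx !add0r !addr0.
rewrite mulNmx !jacS_coordS // !jacN_coord // !jacM_coord //.
rewrite !mul_scalar_mx !scalerA !mulNr !mulVf // !scaleN1r.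
by rewrite !opp_col_mx !add_col_mx mulNmx !addrA.
Qed.

(** The range of [J^T] thus consists of coordinates of actual perturbations, which makes the
    least-norm solution attainable. *)
Lemma trJmx_mul S w xt yt zt lf lg lh :
  (Jmx S w xt yt zt)^T *m col_mx lf (col_mx lg lh)
  = coords w (adjoint_pert S w xt yt zt lf lg lh).
Proof.
have invE (t : R) : t * t^-1 ^+ 2 = t^-1.
  have [->|t0] := eqVneq t 0; first by rewrite invr0 mul0r.
  by field.
have scal (k : nat) (t : R) (l : 'cV_k) :
    ((- t^-1)%:M)^T *m l = t *: - (t^-1 ^+ 2 *: l).
  by rewrite tr_scalar_mx mul_scalar_mx scalerN scalerA invE scaleNr.
have coordSN (t : R) (X : 'M_m) : coordS t (- X) = - coordS t X.
  rewrite /coordS -scalerN -mulmxN; congr (_ *: (_ *m _)).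
  by apply/colP => s; rewrite !mxE.
have coord_pertD (t : R) (Y Z Z' : 'M_(p, m)) :
    coord t (pert t Y (Z + Z')) = coord t (pert t Y Z) + coord t (pert t Y Z').
  by apply/colP => s; rewrite !mxE mulrDl !mulrDr.
rewrite /Jmx /Jtilde /Imx /coords /adjoint_pert /=.
rewrite -/(jacS _ _ _) -/(jacS (theta7 w) _ _) scaleNr -/(jacS _ (blkC S) _).
rewrite -/(jacN _ _ _) -/(jacN (theta5 w) _ _).
rewrite -/(jacM _ _ _) -/(jacM (theta5 w) _ _).
rewrite !(tr_row_mx, tr_col_mx) !mul_col_mx !mul_row_col.
rewrite !mul_col_mx !trmx0 !mul0mx !(add_col_mx, add0r, addr0).
rewrite coordSN coord_pertD -!trjacS_mul -(trjacM_mul _ _ xt).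
rewrite -(trjacM_mul _ _ yt) -!trjacN_mul.
by rewrite linearN mulNmx !scal.
Qed.

(** The last components of [J^T u] are those of [u] divided by nonzero weights, up to sign, so [J^T]
    is injective. *)
Lemma Jmx_gram_unitmx S w xt yt zt :
  theta8 w != 0 -> theta9 w != 0 -> theta10 w != 0 ->
  Jmx S w xt yt zt *m (Jmx S w xt yt zt)^T \in unitmx.
Proof.
move=> t8 t9 t10; apply: gram_unitmx => u.
have scaled0 (k : nat) (t : R) (l : 'cV_k) :
    t != 0 -> t *: - (t^-1 ^+ 2 *: l) = 0 -> l = 0.
  move=> t0 /eqP; rewrite scaler_eq0 (negPf t0) oppr_eq0 scaler_eq0.
  by rewrite expf_eq0 invr_eq0 (negPf t0) => /eqP.
rewrite -[u]vsubmxK -[dsubmx u]vsubmxK trJmx_mul => /eqP.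
rewrite col_mx_eq0 => /andP[_]; rewrite !col_mx_eq0 /=.
case/and3P => /eqP/scaled0-> // /eqP/scaled0-> // /eqP/scaled0-> //.
by rewrite !col_mx0.
Qed.

Lemma adjoint_pert_sparse S w xt yt zt lf lg lh :
  sparsity_preserving S (adjoint_pert S w xt yt zt lf lg lh).
Proof.
split; split; rewrite /= -?pertS_sparse -?pert_sparse //.
by rewrite {1}pertS_sparse; apply/matrixP => i j; rewrite !mxE mulNr.
Qed.

(** Every block carries a factor [t^-1 ^+ 2], which is 0 when [t = 0]. *)
Lemma adjoint_pert_admissible S w xt yt zt lf lg lh :
  weight_admissible w (adjoint_pert S w xt yt zt lf lg lh).
Proof.
split; [|split]; split => /= ->;
  by rewrite /pertS /pert invr0 expr0n /= ?mul0r scale0r ?oppr0.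
Qed.

End BackwardError.

(** * The formula for the structured backward error *)

Theorem theorem4p1 (R : realType) (n m p : nat)
    (A : 'M[R]_n) (B1 B2 : 'M[R]_(m, n)) (C : 'M[R]_m)
    (D : 'M[R]_(p, m)) (E : 'M[R]_p)
    (f : 'cV[R]_n) (g : 'cV[R]_m) (h : 'cV[R]_p)
    (xt : 'cV[R]_n) (yt : 'cV[R]_m) (zt : 'cV[R]_p)
    (t1 t2 t3 t4 t5 t7 t8 t9 t10 : R) :
  let sys := Blocks A B1 B2 C D E f g h in
  let w := Weights t1 t2 t3 t4 t5 t7 t8 t9 t10 in
  let J := Jmx sys w xt yt zt in
  A \is symmetricmx -> C \is symmetricmx -> E \is symmetricmx ->
  B1 != B2 ->
  coefmx sys \in unitmx ->
  0 <= t1 -> 0 <= t2 -> 0 <= t3 -> 0 <= t4 -> 0 <= t5 -> 0 <= t7 ->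
  0 <= t8 -> 0 <= t9 -> 0 <= t10 ->
  t8 != 0 -> t9 != 0 -> t10 != 0 ->
  J *m J^T \in unitmx /\
  is_eta_S2_sps sys w xt yt zt
    (norm2 (J^T *m invmx (J *m J^T) *m residual sys xt yt zt)).
Proof.
move=> sys w J /symmetricmxP Asym /symmetricmxP Csym /symmetricmxP Esym _ _.
move=> _ _ _ _ _ _ _ _ _ t80 t90 t100.
have JJu : J *m J^T \in unitmx by exact: Jmx_gram_unitmx.
split=> //; set r := residual sys xt yt zt.
set l := invmx (J *m J^T) *m r.
(* The three parts of the multiplier [l] belong to the three block rows of the system. *)
pose d := adjoint_pert sys w xt yt zt (usubmx l)
            (usubmx (dsubmx l)) (dsubmx (dsubmx l)).
have JTl : J^T *m l = coords w d by rewrite -trJmx_mul !vsubmxK.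
have dA : (blkA d)^T = blkA d by exact: pertS_sym.
have dC : (blkC d)^T = blkC d by rewrite linearN /= pertS_sym.
have dE : (blkE d)^T = blkE d by exact: pertS_sym.
have d_sparse : sparsity_preserving sys d by exact: adjoint_pert_sparse.
have d_adm : weight_admissible w d by exact: adjoint_pert_admissible.
rewrite -mulmxA -/l JTl; split.
  (* Attainment: [J J^T l = r] says that the coordinates of [d] solve [J v = r], so [d] satisfies
     the perturbed system. *)
  exists d; last by rewrite norm2_coords.
  split=> //; split=> //; split; try exact/symmetricmxP.
  apply/perturbed_system; rewrite -(Jmx_coords (S := sys) (w := w)) //.
  by rewrite -residualE -JTl /l !mulmxA mulmxV // mul1mx.
(* Lower bound: the coordinates of any competitor also solve [J v = r], and [J^T l] is the shortest
   solution. *)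
move=> _ [d' [[[/symmetricmxP A' /symmetricmxP C' /symmetricmxP E' sys']
  sp'] adm'] <-].
rewrite -(norm2_coords w) // -JTl /l mulmxA.
apply: norm2_least => //.
by rewrite Jmx_coords //; move/perturbed_system: sys' ->; rewrite -residualE.
Qed.
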